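(* Let $K$ be a field of characteristic zero and let $\sigma\in S_n$ be an involution ($\sigma^2=\mathrm{id}$). For every $f\in X_\sigma$ the intersection $\Omega(f)\cap X_\sigma$ contains the only element $f$, i.e. $\Omega(f)\cap X_\sigma=\{f\}$.
   Context: $N=\mathrm{UT}(n,K)$ is the group of lower triangular $n\times n$ matrices over $K$ with ones on the diagonal, and $\mathfrak{n}=\mathfrak{ut}(n,K)$ is its Lie algebra of strictly lower triangular matrices, with standard basis $y_{ij}$ ($1\le j<i\le n$, the matrix unit with $1$ in row $i$, column $j$). $N$ acts on the dual space $\mathfrak{n}^*$ by $(\mathrm{Ad}^*_g f)(x)=f(\mathrm{Ad}_g^{-1}x)$, where $\mathrm{Ad}_g x=gxg^{-1}$; $\Omega(f)$ is the orbit of $f$ under this (coadjoint) action. $\Delta^+=\{\varepsilon_j-\varepsilon_i : 1\le j<i\le n\}$ is the set of positive roots of $\mathfrak{gl}(n,K)$; for $\xi=\varepsilon_j-\varepsilon_i\in\Delta^+$ put $j(\xi)=j$, $i(\xi)=i$, $y_\xi=y_{ij}$, and let $r_\xi\in S_n$ be the transposition $(j,i)$. The involution decomposes uniquely as a product of commuting reflections $\sigma=r_1\cdots r_s$, $r_m=r_{\xi_m}$, $\xi_m\in\Delta^+$. Put $\mathcal{S}=\{\xi_1,\dots,\xi_s\}$. $X_\sigma\subset\mathfrak{n}^*$ is the set of all $f$ with $f(y_{\xi_m})\neq0$ for $1\le m\le s$ and $f(y_\gamma)=0$ for all $\gamma\in\Delta^+\setminus\mathcal{S}$. *)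

(* Defs.v *)
From HB Require Import structures.
From mathcomp Require Import all_boot all_order all_fingroup all_algebra.
From mathcomp Require Import classical_sets.

Set Implicit Arguments.
Unset Strict Implicit.
Unset Printing Implicit Defensive.

Import GRing.Theory.

Local Open Scope ring_scope.

(* The positive root eps_j - eps_i (j < i) is encoded by the pair (j, i), with
   indices running over 0, .., n-1. *)
Definition posroot (n : nat) := {p : 'I_n * 'I_n | (p.1 < p.2)%N}.

Definition rootj n (xi : posroot n) : 'I_n := (val xi).1.
Definition rooti n (xi : posroot n) : 'I_n := (val xi).2.

Definition refl n (xi : posroot n) : 'S_n := tperm (rootj xi) (rooti xi).

(* As the reflections commute, the enumeration order used by the product over
   the finite set S is irrelevant. *)
Definition refl_decomp n (sigma : 'S_n) (S : {set posroot n}) : bool :=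
  [forall xi in S, forall eta in S,
     (refl xi * refl eta)%g == (refl eta * refl xi)%g]
  && (sigma == \prod_(xi in S) refl xi)%g.

(* For an involution sigma there is exactly one S to pick, see refl_decompE and
   refl_rootsP below. *)
Definition refl_roots n (sigma : 'S_n) : {set posroot n} :=
  odflt finset.set0 [pick S | refl_decomp sigma S].

Definition UT (K : fieldType) (n : nat) : pred 'M[K]_n :=
  fun g => is_trig_mx g && [forall i, g i i == 1].
Arguments UT : clear implicits.

Definition ymx (K : fieldType) n (xi : posroot n) : 'M[K]_n :=
  delta_mx (rooti xi) (rootj xi).

Definition ut (K : fieldType) (n : nat) : {vspace 'M[K]_n} :=
  <<[seq ymx K xi | xi : posroot n]>>%VS.

Lemma ymx_ut (K : fieldType) n (xi : posroot n) : ymx K xi \in ut K n.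
Proof. by apply/memv_span/map_f; rewrite mem_enum. Qed.

Lemma mem_utP (K : fieldType) n (A : 'M[K]_n) :
  reflect (forall i j : 'I_n, (i <= j)%N -> A i j = 0) (A \in ut K n).
Proof.
apply: (iffP idP) => [|A0].
  rewrite /ut => /coord_span -> i j le_ij; rewrite summxE big1 // => k _.
  rewrite mxE; pose s := [seq ymx K xi | xi : posroot n].
  have ls : (k < size s)%N by rewrite size_map -cardE.
  have /mapP[xi _ ->] := mem_nth 0 ls.
  rewrite mxE; case: eqP => [ei|]; rewrite ?mulr0 //=.
  case: eqP => [ej|]; rewrite ?mulr0 //; case: xi ei ej => -[a b] /= lt_ab.
  by rewrite /rooti /rootj /= => ei ej; move: lt_ab; rewrite -ei -ej ltnNge le_ij.
rewrite [A]matrix_sum_delta rpred_sum // => i _; rewrite rpred_sum // => j _.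
have [/A0->|lt_ji] := leqP i j; first by rewrite scale0r mem0v.
exact/memvZ/(ymx_ut K (Sub (j, i) lt_ji : posroot n)).
Qed.

Definition ybasis (K : fieldType) n (xi : posroot n) : subvs_of (ut K n) :=
  Subvs (ymx_ut K xi).

Definition ut_dual (K : fieldType) (n : nat) := 'Hom(subvs_of (ut K n), K^o).

(* The projection vsproj onto ut is harmless: for g in UT the conjugate already
   lies in ut, see val_Ad. *)
Definition conj_ut (K : fieldType) n (g : 'M[K]_n) (x : subvs_of (ut K n)) :
    subvs_of (ut K n) :=
  vsproj (ut K n) (g *m vsval x *m invmx g).

Lemma conj_ut_is_linear (K : fieldType) n (g : 'M[K]_n) : linear (conj_ut g).
Proof.
move=> a u v.
by rewrite /conj_ut !linearP /= mulmxDl -scalemxAl linearP.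
Qed.

HB.instance Definition _ (K : fieldType) n (g : 'M[K]_n) :=
  GRing.isLinear.Build K (subvs_of (ut K n)) (subvs_of (ut K n)) _
    (conj_ut g) (conj_ut_is_linear g).

Definition Ad (K : fieldType) n (g : 'M[K]_n) : 'End(subvs_of (ut K n)) :=
  linfun (conj_ut g).

(* For g in UT the endomorphism Ad g is bijective (lker0_Ad), so ^-1%VF is its
   two-sided inverse. *)
Definition coAd (K : fieldType) n (g : 'M[K]_n) (f : ut_dual K n) :
    ut_dual K n :=
  (f \o (Ad g)^-1)%VF.

Definition coorbit (K : fieldType) n (f : ut_dual K n) : set (ut_dual K n) :=
  [set h | exists2 g, g \in UT K n & h = coAd g f]%classic.

Definition Xsigma (K : fieldType) n (sigma : 'S_n) : set (ut_dual K n) :=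
  [set f : ut_dual K n |
    (forall xi, xi \in refl_roots sigma -> f (ybasis K xi) != 0) /\
    (forall gamma, gamma \notin refl_roots sigma -> f (ybasis K gamma) = 0)]%classic.

Arguments Xsigma K {n} sigma _.

Section Adjoint.
Variables (K : fieldType) (n : nat).
Implicit Types (g : 'M[K]_n) (x : subvs_of (ut K n)).

Lemma UT_unit g : g \in UT K n -> g \in unitmx.
Proof.
case/andP=> tg /forallP g1; rewrite unitmxE det_trig //.
by rewrite big1 ?unitr1 // => i _; apply/eqP.
Qed.

Lemma mul_ut_invmx g A : g \in UT K n -> A \in ut K n -> A *m invmx g \in ut K n.
Proof.
move=> UTg /mem_utP A0; set B := A *m _.
have defA : A = B *m g by rewrite mulmxKV ?UT_unit.
case/andP: (UTg) => /is_trig_mxP tg /forallP g1; apply/mem_utP => i j.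
have [m] := ubnP (n - j); elim: m j => // m IHm j lt_m le_ij.
have := A0 i j le_ij; rewrite defA mxE (bigD1 j) //= (eqP (g1 j)) mulr1.
rewrite big1 ?addr0 // => k ne_kj; have [lt_kj|le_jk] := ltnP k j.
  by rewrite tg ?mulr0.
have lt_jk : (j < k)%N by rewrite ltn_neqAle le_jk eq_sym ne_kj.
rewrite IHm ?mul0r ?(leq_trans le_ij) //.
by rewrite (leq_trans _ (lt_m : n - j <= m)%N) // ltn_sub2l.
Qed.

Lemma UT_mul_ut g A : g \in UT K n -> A \in ut K n -> g *m A \in ut K n.
Proof.
case/andP=> /is_trig_mxP tg _ /mem_utP A0; apply/mem_utP => i j le_ij.
rewrite mxE big1 // => k _; have [lt_ik|le_ki] := ltnP i k.
  by rewrite tg ?mul0r.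
by rewrite A0 ?mulr0 // (leq_trans le_ki).
Qed.

Lemma UT_utP g : (g \in UT K n) = (g - 1%:M \in ut K n).
Proof.
apply/idP/mem_utP => [/andP[/is_trig_mxP tg /forallP g1] i j|g0].
  rewrite !mxE leq_eqVlt => /predU1P[/val_inj<-|lt_ij].
    by rewrite eqxx (eqP (g1 i)) subrr.
  by rewrite tg // (_ : (i == j) = false) ?subrr // -val_eqE ltn_eqF.
have gE (i j : 'I_n) : (i <= j)%N -> g i j = (i == j)%:R.
  by move=> /g0; rewrite !mxE => /eqP; rewrite subr_eq0 => /eqP.
apply/andP; split; last by apply/forallP => i; rewrite gE ?eqxx.
by apply/is_trig_mxP => i j lt_ij; rewrite gE 1?ltnW // -val_eqE ltn_eqF.
Qed.

Lemma UT_invmx g : g \in UT K n -> invmx g \in UT K n.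
Proof.
move=> UTg; rewrite UT_utP; have -> : invmx g - 1%:M = (1%:M - g) *m invmx g.
  by rewrite mulmxBl mul1mx mulmxV ?UT_unit.
by rewrite mul_ut_invmx // -memvN opprB -UT_utP.
Qed.

Lemma val_Ad g x : g \in UT K n -> vsval (Ad g x) = g *m vsval x *m invmx g.
Proof.
move=> UTg; rewrite lfunE /= /conj_ut vsprojK //.
by rewrite mul_ut_invmx ?UT_mul_ut ?subvsP.
Qed.

Lemma AdK g : g \in UT K n -> cancel (Ad g) (Ad (invmx g)).
Proof.
move=> UTg x; apply: val_inj; rewrite /= !val_Ad ?UT_invmx // invmxK.
by rewrite !mulmxA mulVmx ?UT_unit // mul1mx mulmxKV ?UT_unit.
Qed.

Lemma lker0_Ad g : g \in UT K n -> lker (Ad g) == 0%VS.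
Proof. by move=> UTg; apply/lker0P/(can_inj (AdK UTg)). Qed.

Lemma Ad_inv g : g \in UT K n -> ((Ad g)^-1)%VF = Ad (invmx g).
Proof.
move=> UTg; apply/lfunP => x.
by rewrite -[x in LHS](AdK (UT_invmx UTg)) invmxK lker0_lfunK ?lker0_Ad.
Qed.

Lemma coAdE g (f : ut_dual K n) x :
  g \in UT K n -> coAd g f x = f (Ad (invmx g) x).
Proof. by move=> UTg; rewrite /coAd Ad_inv // comp_lfunE. Qed.

End Adjoint.

Section Decomposition.
Variable n : nat.
Implicit Types (xi eta : posroot n) (S : {set posroot n}) (sigma : 'S_n).

Let disj xi eta := [&& rootj xi != rootj eta, rootj xi != rooti eta,
                       rooti xi != rootj eta & rooti xi != rooti eta].

Lemma rootj_neq xi : rootj xi != rooti xi.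
Proof. by rewrite -val_eqE ltn_eqF //; apply: valP xi. Qed.

Lemma posroot_eq xi eta :
  rootj xi = rootj eta -> rooti xi = rooti eta -> xi = eta.
Proof.
by case: xi eta => -[a b] ? [[c d] ?]; rewrite /rootj /rooti => /= ? ?; apply/val_inj/pair_equal_spec.
Qed.

Let no_chain xi eta : rooti xi = rootj eta -> rooti eta = rootj xi -> False.
Proof.
move=> e1 e2; have lt1 : (rootj xi < rooti xi)%N := valP xi.
have lt2 : (rootj eta < rooti eta)%N := valP eta.
by rewrite -e1 e2 ltnNge ltnW in lt2.
Qed.

Let comm_disj xi eta :
  xi != eta -> (refl xi * refl eta == refl eta * refl xi)%g -> disj xi eta.
Proof.
move=> ne_xe /eqP/permP E; rewrite /disj /refl in E *.
have Ea := E (rootj xi); have Eb := E (rooti xi); move: Ea Eb {E}.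
have ltx : (rootj xi < rooti xi)%N := valP xi.
have lte : (rootj eta < rooti eta)%N := valP eta.
have ne : ~ (rootj xi = rootj eta /\ rooti xi = rooti eta).
  by case=> ? ?; case/eqP: ne_xe; apply: posroot_eq.
move: (rootj xi) (rooti xi) (rootj eta) (rooti eta) ltx lte ne => a b c d.
move=> lt_ab lt_cd ne; rewrite !permM tpermL tpermR.
have ne_ab : a <> b by move=> eab; rewrite eab ltnn in lt_ab.
have ne_cd : c <> d by move=> ecd; rewrite ecd ltnn in lt_cd.
have ne' : ~ (a = d /\ b = c).
  by case=> ? ?; subst; have := ltn_trans lt_ab lt_cd; rewrite ltnn.
case: (tpermP c d a) => [?|?|nac nad]; case: (tpermP c d b) => [?|?|nbc nbd] Ea Eb;
  do ?by (apply/and4P; split; apply/eqP).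
all: exfalso; move: Ea Eb.
all: do 2?[case: tpermP => ? ?]; try solve [congruence | intuition congruence].
Qed.

Let disj_comm xi eta : disj xi eta -> commute (refl xi) (refl eta).
Proof.
case/and4P => ac ad bc bd; apply/commgP/conjg_fixP.
by rewrite /refl tpermJ !tpermD // eq_sym.
Qed.

Let prod_disj (s : seq (posroot n)) (pi := (\prod_(xi <- s) refl xi)%g) :
  uniq s -> {in s &, forall xi eta, xi != eta -> disj xi eta} ->
  [/\ {in s, forall xi, pi (rootj xi) = rooti xi},
      {in s, forall xi, pi (rooti xi) = rootj xi} &
      forall k, {in s, forall xi, k != rootj xi /\ k != rooti xi} -> pi k = k].
Proof.
rewrite {}/pi; elim: s => [|xi s IHs] /=.
  by move=> _ _; split=> // k _; rewrite big_nil perm1.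
case/andP=> xi_s uniq_s ds; rewrite big_cons.
have ds' : {in s &, forall xi eta, xi != eta -> disj xi eta}.
  by move=> a b as_ bs; apply: ds; rewrite inE (as_, bs) orbT.
have dxi eta : eta \in s -> disj xi eta.
  move=> eta_s; apply: ds; rewrite ?inE ?eqxx ?eta_s ?orbT //.
  by apply: contraNneq xi_s => ->.
have [IHj IHi IHk] := IHs uniq_s ds'.
split=> [eta|eta|k kP]; rewrite permM ?inE.
- case/predU1P=> [->|eta_s].
    by rewrite /refl tpermL IHk // => z /dxi/and4P[].
  by have /and4P[? ? ? ?] := dxi _ eta_s; rewrite /refl tpermD ?IHj.
- case/predU1P=> [->|eta_s].
    by rewrite /refl tpermR IHk // => z /dxi/and4P[].
  by have /and4P[? ? ? ?] := dxi _ eta_s; rewrite /refl tpermD ?IHi.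
have [k1 k2] := kP xi (mem_head _ _).
rewrite /refl tpermD 1?eq_sym // IHk // => eta eta_s.
by apply: kP; rewrite inE eta_s orbT.
Qed.

Let big_enumE S : (\prod_(xi in S) refl xi = \prod_(xi <- enum S) refl xi)%g.
Proof. by rewrite -big_filter deprecated_filter_index_enum. Qed.

Lemma refl_decompE sigma S : (sigma * sigma = 1)%g ->
  refl_decomp sigma S = (S == [set xi | sigma (rootj xi) == rooti xi]%SET).
Proof.
move=> sigma2; have sigmaK k : sigma (sigma k) = k by rewrite -permM sigma2 perm1.
apply/andP/eqP=> [[/'forall_in_forall_inP cS /eqP def_s]|->].
  have [||pj pi pk] := prod_disj (s := enum S); first exact: enum_uniq.
    move=> a b; rewrite !mem_enum => aS bS ne_ab.
    exact/comm_disj/cS.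
  rewrite -big_enumE -def_s in pj pi pk.
  apply/setP => xi; rewrite inE; apply/idP/eqP=> [xiS|s_xi].
    by rewrite pj ?mem_enum.
  apply: contraTT isT => xi_S; have := rootj_neq xi; rewrite -s_xi => ne_xi.
  have [eta etaS] : exists2 eta, eta \in S &
      (rootj xi == rootj eta) || (rootj xi == rooti eta).
    apply/exists_inP; apply: contraTT ne_xi; rewrite negb_exists_in => /forall_inP H.
    rewrite pk ?eqxx // => eta; rewrite mem_enum => /H.
    by rewrite negb_or => /andP[].
  case/orP=> /eqP e.
    rewrite e pj ?mem_enum // in s_xi.
    by rewrite (posroot_eq e (esym s_xi)) etaS in xi_S.
  rewrite e pi ?mem_enum // in s_xi.
  by case: (no_chain (esym s_xi) (esym e)).
set S0 := finset _.
have dS xi eta : xi \in S0 -> eta \in S0 -> xi != eta -> disj xi eta.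
  rewrite !inE => /eqP sx /eqP se ne.
  have ne_j : rootj xi != rootj eta.
    apply: contraNneq ne => e; apply/eqP/posroot_eq => //.
    by rewrite -sx -se e.
  have ne_ji : rootj xi != rooti eta.
    apply: contraNneq (rootj_neq xi) => e.
    have e' : rooti xi = rootj eta by rewrite -sx e -se sigmaK.
    by case: (no_chain e' (esym e)).
  rewrite /disj ne_j ne_ji -sx -se (inj_eq perm_inj) ne_j andbT /=.
  by apply: contraNneq ne_ji => e; rewrite -se -e sigmaK.
split.
  apply/'forall_in_forall_inP => xi xiS eta etaS; apply/eqP.
  have [->//|ne] := eqVneq xi eta; exact/disj_comm/dS.
have [||pj pi pk] := prod_disj (s := enum S0); first exact: enum_uniq.
  by move=> a b; rewrite !mem_enum; apply: dS.
rewrite -big_enumE in pj pi pk; apply/eqP/permP => k.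
have [lt_k|gt_k|e_k] := ltngtP k (sigma k).
- pose xi : posroot n := Sub (k, sigma k) lt_k.
  have xiS : xi \in enum S0 by rewrite mem_enum inE.
  by have := pj xi xiS.
- pose xi : posroot n := Sub (sigma k, k) gt_k.
  have xiS : xi \in enum S0 by rewrite mem_enum inE /= sigmaK.
  by have := pi xi xiS.
have sk : sigma k = k by apply: val_inj.
rewrite pk // => xi; rewrite mem_enum inE => /eqP sx.
split; apply: contraNneq (rootj_neq xi) => e; first by rewrite -sx -e sk.
by rewrite -[rootj xi]sigmaK sx -e sk.
Qed.

Lemma refl_rootsP sigma : (sigma * sigma = 1)%g ->
  refl_roots sigma = [set xi | sigma (rootj xi) == rooti xi]%SET.
Proof.
move=> sigma2; rewrite /refl_roots.
case: pickP => [S|/(_ [set xi | sigma (rootj xi) == rooti xi]%SET)].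
  by rewrite refl_decompE // => /eqP.
by rewrite refl_decompE // eqxx.
Qed.

End Decomposition.

(* Main.v *)
Require Import Defs.
From HB Require Import structures.
From mathcomp Require Import all_boot all_order all_fingroup all_algebra.
From mathcomp Require Import classical_sets.

(** The functional [h = coAd g f] is determined by [h (g x) = f (x g)] for
    strictly lower triangular [x]: [ut] is stable under multiplication by [g] on
    either side, so [Ad g] carries [x g] to [g x] and no inverse of [g] needs to
    be computed ([coAd_lmul]).

    Take [x = y_xi], with [xi] a root of the decomposition of [sigma].  The matrix
    [y_xi g] lives in row [i(xi)], with entry [g j(xi) j(xi) = 1] at [xi], and
    [g y_xi] lives in column [j(xi)], with entry [g i(xi) i(xi) = 1] at [xi].
    The transpositions of [sigma] have disjoint supports, so no other root of
    the decomposition meets that row or that column.  A functional in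
    [Xsigma K sigma] only reads the entries at the roots of the decomposition
    ([Xsigma_sum]), hence [f (y_xi g) = f y_xi] and [h (g y_xi) = h y_xi] as soon
    as [f] and [h] both lie in [Xsigma K sigma].  Thus [h y_xi = f y_xi]; at all
    other roots both functionals vanish, so [h = f]. *)

Set Implicit Arguments.
Unset Strict Implicit.
Unset Printing Implicit Defensive.

Import GRing.Theory.

Local Open Scope ring_scope.

Lemma ut_sum_ybasis (K : fieldType) n (x : subvs_of (ut K n)) :
  x = \sum_xi vsval x (rooti xi) (rootj xi) *: ybasis K xi.
Proof.
apply: val_inj; rewrite /= linear_sum /=; apply/matrixP => a b.
rewrite summxE; under eq_bigr => xi _ do rewrite !mxE.
have [le_ab|lt_ba] := leqP a b.
  have /mem_utP -> // := subvsP x.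
  rewrite big1 // => xi _; case: eqP => [ea|]; rewrite ?mulr0 //=.
  case: eqP => [eb|]; rewrite ?mulr0 //.
  by have := valP xi; rewrite -[(val xi).1]eb -[(val xi).2]ea ltnNge le_ab.
rewrite (bigD1 (Sub (b, a) lt_ba : posroot n)) //= !eqxx mulr1 big1 ?addr0 //.
move=> xi ne_xi; case: eqP => [ea|]; rewrite ?mulr0 //=.
case: eqP => [eb|]; rewrite ?mulr0 //.
by case/eqP: ne_xi; apply: posroot_eq.
Qed.

Lemma ut_dual_sum (K : fieldType) n (f : ut_dual K n) (x : subvs_of (ut K n)) :
  f x = \sum_xi vsval x (rooti xi) (rootj xi) * f (ybasis K xi).
Proof.
rewrite {1}[x]ut_sum_ybasis linear_sum; apply: eq_bigr => xi _.
exact: linearZ.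
Qed.

Lemma Xsigma_sum (K : fieldType) n (sigma : 'S_n) (f : ut_dual K n)
    (x : subvs_of (ut K n)) :
  Xsigma K sigma f ->
  f x = \sum_(xi in refl_roots sigma)
          vsval x (rooti xi) (rootj xi) * f (ybasis K xi).
Proof.
case=> _ f0; rewrite ut_dual_sum [RHS]big_mkcond /=; apply: eq_bigr => xi _.
by case: ifPn => // /f0->; rewrite mulr0.
Qed.

(** An involution moves each point to a single partner, so two of its
    transpositions that share an upper or a lower index coincide. *)
Lemma refl_roots_injj n (sigma : 'S_n) : (sigma * sigma = 1)%g ->
  {in refl_roots sigma &, injective (@rootj n)}.
Proof.
move=> /refl_rootsP-> xi eta; rewrite !inE => /eqP sx /eqP se e.
by apply: posroot_eq => //; rewrite -sx -se e.
Qed.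

Lemma refl_roots_inji n (sigma : 'S_n) : (sigma * sigma = 1)%g ->
  {in refl_roots sigma &, injective (@rooti n)}.
Proof.
move=> /refl_rootsP-> xi eta; rewrite !inE => /eqP sx /eqP se e.
by apply: posroot_eq => //; apply: (@perm_inj _ sigma); rewrite sx se.
Qed.

Lemma Xsigma_pick (K : fieldType) n (sigma : 'S_n) (f : ut_dual K n)
    (x : subvs_of (ut K n)) xi :
    Xsigma K sigma f -> xi \in refl_roots sigma ->
    {in refl_roots sigma,
      forall eta, vsval x (rooti eta) (rootj eta) = (eta == xi)%:R} ->
  f x = f (ybasis K xi).
Proof.
move=> Xf Sxi xE; rewrite (Xsigma_sum x Xf) (bigD1 xi) //= xE // eqxx mul1r.
rewrite big1 ?addr0 // => eta /andP[Seta /negPf ne].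
by rewrite xE // ne mul0r.
Qed.

Lemma delta_mulmxE (R : pzRingType) m n p (i : 'I_m) (j : 'I_n)
    (A : 'M[R]_(n, p)) a b :
  (delta_mx i j *m A) a b = (a == i)%:R * A j b.
Proof.
rewrite mxE (bigD1 j) //= big1 => [|k /negPf ne]; rewrite mxE ?eqxx ?andbT ?addr0 //.
by rewrite ne andbF mul0r.
Qed.

Lemma mulmx_deltaE (R : pzRingType) m n p (i : 'I_n) (j : 'I_p)
    (A : 'M[R]_(m, n)) a b :
  (A *m delta_mx i j) a b = A a i * (b == j)%:R.
Proof.
rewrite mxE (bigD1 i) //= big1 => [|k /negPf ne]; rewrite mxE ?eqxx ?addr0 //.
by rewrite ne mulr0.
Qed.

Lemma ut_mul_UT (K : fieldType) n (g A : 'M[K]_n) :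
  g \in UT K n -> A \in ut K n -> A *m g \in ut K n.
Proof. by move=> UTg utA; rewrite -[g]invmxK mul_ut_invmx ?UT_invmx. Qed.

Lemma UT_diag (K : fieldType) n (g : 'M[K]_n) i : g \in UT K n -> g i i = 1.
Proof. by case/andP=> _ /forallP/(_ i)/eqP. Qed.

(** [Ad (invmx g)] turns [g x] into [x g]; these one-sided products, unlike the
    conjugate of [x], have explicit entries when [x] is a matrix unit. *)
Lemma coAd_lmul (K : fieldType) n (g : 'M[K]_n) (f : ut_dual K n)
    (x : subvs_of (ut K n)) :
  g \in UT K n ->
  coAd g f (vsproj (ut K n) (g *m vsval x))
    = f (vsproj (ut K n) (vsval x *m g)).
Proof.
move=> UTg; rewrite coAdE //; congr (f _); apply: val_inj.
rewrite /= val_Ad ?UT_invmx // vsprojK ?vsprojK; first last.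
- exact: UT_mul_ut (subvsP x).
- exact: ut_mul_UT (subvsP x).
by rewrite invmxK mulmxA mulVmx ?UT_unit // mul1mx.
Qed.

Lemma coAd1 (K : fieldType) n (f : ut_dual K n) : coAd 1%:M f = f.
Proof.
have UT1 : 1%:M \in UT K n by rewrite UT_utP subrr mem0v.
apply/lfunP => x; rewrite coAdE //; congr (f _); apply: val_inj.
by rewrite /= val_Ad ?UT_invmx // invmxK invmx1 mul1mx mulmx1.
Qed.

Lemma coAd_Xsigma_ybasis (K : fieldType) n (sigma : 'S_n) (g : 'M[K]_n)
    (f : ut_dual K n) xi :
    (sigma * sigma = 1)%g -> g \in UT K n ->
    Xsigma K sigma f -> Xsigma K sigma (coAd g f) ->
    xi \in refl_roots sigma ->
  coAd g f (ybasis K xi) = f (ybasis K xi).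
Proof.
move=> sigma2 UTg Xf Xh Sxi; have := coAd_lmul f (ybasis K xi) UTg.
have uty := ymx_ut K xi.
rewrite (Xsigma_pick Xf Sxi) => [|eta Seta]; last first.
  rewrite vsprojK ?ut_mul_UT //= delta_mulmxE.
  rewrite (inj_in_eq (refl_roots_inji sigma2)) //.
  by have [->|_] := eqVneq eta xi; rewrite ?mul0r // UT_diag ?mulr1.
rewrite (Xsigma_pick Xh Sxi) // => eta Seta.
rewrite vsprojK ?UT_mul_ut //= mulmx_deltaE.
rewrite (inj_in_eq (refl_roots_injj sigma2)) //.
by have [->|_] := eqVneq eta xi; rewrite ?mulr0 // UT_diag ?mulr1.
Qed.

Theorem corollary1p5 (K : fieldType) (n : nat) (sigma : 'S_n)
  (charK : [pchar K]%R =i pred0) (sigma_inv : (sigma * sigma = 1)%g)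
  (f : ut_dual K n) (Xf : Xsigma K sigma f) :
  (coorbit f `&` Xsigma K sigma = [set f])%classic.
Proof.
apply/seteqP; split=> [h [[g UTg ->] Xh]|_ ->].
  apply/lfunP => x; rewrite ut_dual_sum [RHS]ut_dual_sum.
  apply: eq_bigr => xi _; congr (_ * _).
  have [Sxi|Sxi] := boolP (xi \in refl_roots sigma).
    exact: coAd_Xsigma_ybasis Xh Sxi.
  by rewrite Xh.2 ?Xf.2.
split=> //; exists 1%:M; last by rewrite coAd1.
by rewrite UT_utP subrr mem0v.
Qed.
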